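(* Let $G$ be a countable discrete amenable group, $X=\mathbb{N}^G$, and let $\phi\colon X\to\mathbb{R}$ be an exp-summable potential with summable variation according to an exhausting sequence $\{E_m\}_m$ of $G$. If $\mu$ is a $G$-invariant Borel probability measure on $X$ that is a Bowen-Gibbs measure for $\phi$ and $H(\mu)<\infty$, then $\mu$ is an equilibrium measure for $\phi$.
   Context: $\mathbb{N}$ is the set of non-negative integers; $\mathcal{F}(G)$ is the set of nonempty finite subsets of $G$. $X=\mathbb{N}^G$ has the product topology and Borel $\sigma$-algebra. $x_D$ is the restriction of $x$ to $D\subseteq G$; for $w\in\mathbb{N}^F$, $[w]=\{x:x_F=w\}$. $G$ acts by $(g\cdot x)(h)=x(hg)$; $\mathcal{M}_G(X)$ is the set of $G$-invariant Borel probability measures on $X$. $\phi_F(x)=\sum_{g\in F}\phi(g\cdot x)$. $F\in\mathcal F(G)$ is $(K,\delta)$-invariant if $|KF\,\triangle\,F|<\delta|F|$; $G$ is amenable if such $F$ exist for all $K\in\mathcal{F}(G),\delta>0$. $\lim_{F\to G}\varphi(F)=L$ means: for every $\epsilon>0$ there are $K\in\mathcal F(G),\delta>0$ with $|\varphi(F)-L|<\epsilon$ for every $(K,\delta)$-invariant $F$. An exhausting sequence is a sequence $\{E_m\}_{m\ge0}$ of finite subsets of $G$ with $E_0=\emptyset$, $E_1=\{1_G\}$, strictly increasing, with union $G$. With $\delta_E(\phi)=\sup\{|\phi(x)-\phi(y)|:x_E=y_E\}$, $\phi$ has summable variation according to $\{E_m\}_m$ if $\sum_{m\ge1}|E_{m+1}^{-1}\setminus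 E_m^{-1}|\,\delta_{E_m}(\phi)<\infty$. $\phi$ is exp-summable if $\sum_{a\in\mathbb{N}}\exp(\sup\{\phi(x):x(1_G)=a\})<\infty$ (so $\phi$ is bounded above and $\int\phi\,d\nu\in[-\infty,\infty)$ for every probability measure $\nu$). Bowen-Gibbs measure: a Borel probability measure $\mu$ on $X$ is a Bowen-Gibbs measure for $\phi$ if there is $p\in\mathbb{R}$ such that for every $\epsilon>0$ there are $K\in\mathcal{F}(G)$ and $\delta>0$ with $\exp(-\epsilon|F|)\le\frac{\mu([x_F])}{\exp(\phi_F(x)-p|F|)}\le\exp(\epsilon|F|)$ for every $(K,\delta)$-invariant $F\in\mathcal{F}(G)$ and every $x\in X$. Entropy: $H_F(\nu)=-\sum_{w\in\mathbb{N}^F}\nu([w])\log\nu([w])$ (with $0\log0=0$) and $H(\nu)=H_{\{1_G\}}(\nu)$. For $\nu\in\mathcal{M}_G(X)$ with $H(\nu)<\infty$, the Kolmogorov-Sinai entropy is $h(\nu)=\lim_{F\to G}\frac1{|F|}H_F(\nu)$. (If $\int\phi\,d\nu>-\infty$ then $H(\nu)<\infty$.) Equilibrium measure: $\mu\in\mathcal{M}_G(X)$ is an equilibrium measure for $\phi$ if $\int\phi\,d\mu>-\infty$ and $h(\mu)+\int\phi\,d\mu=\sup\{h(\nu)+\int\phi\,d\nu:\nu\in\mathcal{M}_G(X),\ \int\phi\,d\nu>-\infty\}$. *)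

(* Defs.v *)
From HB Require Import structures.
From mathcomp Require Import all_boot all_order all_algebra finmap.
From mathcomp Require Import all_classical all_reals all_analysis.

Set Implicit Arguments.
Unset Strict Implicit.
Unset Printing Implicit Defensive.

Import Order.TTheory GRing.Theory Num.Theory.
Import numFieldTopology.Exports numFieldNormedType.Exports.

Local Open Scope classical_set_scope.
Local Open Scope fset_scope.
Local Open Scope ring_scope.
Local Open Scope ereal_scope.

Section FiniteSubsets.
Variables (R : realType) (G : groupType).

Definition fset_mulg (K F : {fset G}) : {fset G} :=
  [fset (k * f)%g | k in K, f in F].

Definition fset_invg (F : {fset G}) : {fset G} := [fset (f^-1)%g | f in F].

Definition fset_symdiff (A B : {fset G}) : {fset G} :=
  (A `\` B) `|` (B `\` A).

Definition almost_invariant (K : {fset G}) (delta : R) (F : {fset G}) : Prop :=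
  (#|` fset_symdiff (fset_mulg K F) F|%:R < delta * #|` F|%:R)%R.

Definition amenable : Prop :=
  forall (K : {fset G}) (delta : R), K != fset0 -> (0 < delta)%R ->
    exists2 F : {fset G}, F != fset0 & almost_invariant K delta F.

(* The filter of "F -> G": [f @ to_group --> L] is the limit along
   (K, delta)-invariant sets. It is proper exactly when G is amenable. *)
Definition to_group : set_system {fset G} :=
  filter_from [set Kd : {fset G} * R | Kd.1 != fset0 /\ (0 < Kd.2)%R]
    (fun Kd => [set F | F != fset0 /\ almost_invariant Kd.1 Kd.2 F]).

Definition exhausting_sequence (E : nat -> {fset G}) : Prop :=
  [/\ E 0%N = fset0, E 1%N = [fset 1%g],
      forall m, E m `<` E m.+1 &
      forall g : G, exists m, g \in E m].

End FiniteSubsets.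
Arguments to_group : clear implicits.
Arguments amenable : clear implicits.

Section FullShift.
Variables (R : realType) (G : groupType).

(* nat carries the discrete topology. *)
Definition full_shift : topologicalType := prod_topology (fun _ : G => nat).

Definition borel_shift := g_sigma_algebraType (@open full_shift).

Definition shift_act (g : G) (x : full_shift) : full_shift :=
  fun h => x (h * g)%g.

Definition restriction (F : {fset G}) (x : full_shift) : {ffun F -> nat} :=
  [ffun g : F => x (val g)].

Definition cylinder (F : {fset G}) (w : {ffun F -> nat}) : set full_shift :=
  [set x | restriction F x = w].

Definition invariant_measure (mu : probability borel_shift R) : Prop :=
  forall (g : G) (A : set borel_shift), measurable A ->
    mu (shift_act g @^-1` A) = mu A.

Definition ergodic_sum (phi : full_shift -> R) (F : {fset G}) (x : full_shift) :
    R :=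
  (\sum_(g <- F) phi (shift_act g x))%R.

Definition local_variation (phi : full_shift -> R) (E : {fset G}) : \bar R :=
  ereal_sup [set z | exists x y : full_shift,
    restriction E x = restriction E y /\ z = `|phi x - phi y|%:E].

Definition summable_variation (E : nat -> {fset G}) (phi : full_shift -> R) :
    Prop :=
  \sum_(1 <= m <oo)
    #|` fset_invg (E m.+1) `\` fset_invg (E m)|%:R%:E * local_variation phi (E m)
  < +oo.

Definition exp_summable (phi : full_shift -> R) : Prop :=
  \sum_(0 <= a <oo)
    expeR (ereal_sup [set (phi x)%:E | x in [set x : full_shift | x 1%g = a]])
  < +oo.

Definition bowen_gibbs (phi : full_shift -> R) (mu : probability borel_shift R) :
    Prop :=
  exists p : R, forall eps : R, (0 < eps)%R ->
    exists (K : {fset G}) (delta : R), [/\ K != fset0, (0 < delta)%R &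
      forall F : {fset G}, F != fset0 -> almost_invariant K delta F ->
      forall x : full_shift,
        (expR (- eps * #|` F|%:R)
           <= fine (mu (cylinder (restriction F x)))
                / expR (ergodic_sum phi F x - p * #|` F|%:R)
           <= expR (eps * #|` F|%:R))%R].

(* [ln 0 = 0] in the library; the summands are nonnegative, so that the sum
   over the countable set of words is an unordered sum in [0, +oo]. *)
Definition shannon_entropy (F : {fset G}) (nu : probability borel_shift R) :
    \bar R :=
  \esum_(w in [set: {ffun F -> nat}])
    (- (fine (nu (cylinder w)) * ln (fine (nu (cylinder w)))))%:E.

Definition entropy1 (nu : probability borel_shift R) : \bar R :=
  shannon_entropy [fset 1%g] nu.

(* Meaningful for invariant nu with [entropy1 nu < +oo], for which the limit
   exists when G is amenable. *)
Definition ks_entropy (nu : probability borel_shift R) : \bar R :=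
  lim ((fun F : {fset G} => (#|` F|%:R^-1)%:E * shannon_entropy F nu)
         @ to_group R G).

Definition phi_integral (phi : full_shift -> R) (nu : probability borel_shift R) :
    \bar R :=
  \int[nu]_x (phi x)%:E.

Definition equilibrium_measure (phi : full_shift -> R)
    (mu : probability borel_shift R) : Prop :=
  [/\ invariant_measure mu, -oo < phi_integral phi mu &
      ks_entropy mu + phi_integral phi mu =
      ereal_sup [set ks_entropy nu + phi_integral phi nu |
        nu in [set nu : probability borel_shift R |
                invariant_measure nu /\ -oo < phi_integral phi nu]]].

End FullShift.

(* Main.v *)
(* For a set F on which the Bowen-Gibbs bounds hold with error eps, the Gibbs
   inequality with mu as reference measure gives, for every invariant nu,
   H_F(nu) <= - int log mu[x_F] dnu <= |F| (p + eps - int phi dnu), while for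
   nu = mu the first inequality is an equality and the second one is reversed
   up to 2 eps |F|.  Hence h(nu) + int phi dnu <= p with equality at mu.
   In particular the limit defining h(mu) exists without the Ornstein-Weiss
   lemma.  Integrability of phi under mu follows from
   H_F(mu) <= |F| H(mu) < oo, since phi is bounded above.  Summable variation
   serves only to make phi continuous, hence measurable. *)
Require Import Defs.
From HB Require Import structures.
From mathcomp Require Import all_boot all_order all_algebra finmap.
From mathcomp Require Import all_classical all_reals all_analysis.
From mathcomp Require Import measurable_realfun ring lra.

Set Implicit Arguments.
Unset Strict Implicit.
Unset Printing Implicit Defensive.

Import Order.TTheory GRing.Theory Num.Theory.
Import numFieldTopology.Exports numFieldNormedType.Exports.

Local Open Scope classical_set_scope.
Local Open Scope fset_scope.
Local Open Scope ring_scope.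
Local Open Scope ereal_scope.

(** * Almost invariant sets as a filter base *)

Section Filter.
Variables (R : realType) (G : groupType).
Implicit Types K F : {fset G}.

Lemma card_fset_mulg1 (k : G) F : #|` fset_mulg [fset k] F| = #|` F|.
Proof.
have -> : fset_mulg [fset k] F = [fset (k * f)%g | f in F].
  apply/fsetP => x; apply/imfset2P/imfsetP => /=.
    by move=> [y]; rewrite inE => /eqP -> [f fF ->]; exists f.
  by move=> [f fF ->]; exists k; rewrite ?inE//; exists f.
by apply: card_imfset => x y /= /mulgI.
Qed.

(* The symmetric difference of K F and F is not monotone in K, but for k in K1
   one has |F \ K1 F| <= |F \ k F| = |k F \ F| <= |K F \ F|. *)
Lemma card_symdiff_mulg_sub (K1 K F : {fset G}) : K1 != fset0 -> K1 `<=` K ->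
  (#|` fset_symdiff (fset_mulg K1 F) F| <=
   2 * #|` fset_symdiff (fset_mulg K F) F|)%N.
Proof.
move=> /fset0Pn[k kK1] K1K.
have mulgS (A B : {fset G}) : A `<=` B -> fset_mulg A F `<=` fset_mulg B F.
  move=> /fsubsetP AB; apply/fsubsetP => x /imfset2P[a /= aA [f fF ->]].
  by apply/imfset2P; exists a; [exact: AB|exists f].
have dl : (#|` fset_mulg K1 F `\` F| <= #|` fset_symdiff (fset_mulg K F) F|)%N.
  apply/fsubset_leq_card/(fsubset_trans _ (fsubsetUl _ _)).
  by apply: fsetSD; exact: mulgS.
have kK : [fset k] `<=` K1 by rewrite fsub1set.
have dr : (#|` F `\` fset_mulg K1 F| <= #|` fset_symdiff (fset_mulg K F) F|)%N.
  apply: (@leq_trans #|` F `\` fset_mulg [fset k] F|).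
    by apply/fsubset_leq_card/fsetDS/mulgS.
  apply: (@leq_trans #|` fset_mulg [fset k] F `\` F|).
    by rewrite !cardfsD card_fset_mulg1 fsetIC.
  apply/fsubset_leq_card/(fsubset_trans _ (fsubsetUl _ _)).
  by apply: fsetSD; apply: mulgS; exact: fsubset_trans K1K.
rewrite mul2n -addnn (leq_trans _ (leq_add dl dr))//.
by rewrite /fset_symdiff cardfsU leq_subr.
Qed.

Lemma to_group_filter : Filter (to_group R G).
Proof.
apply: filter_from_filter.
  exists ([fset 1%g], 1%R); split => //=.
  by apply/fset0Pn; exists 1%g; rewrite inE.
move=> [K1 d1] [K2 d2] /= [K10 d10] [K20 d20].
(* Halving the smaller tolerance absorbs the factor 2 lost in [card_symdiff_mulg_sub] when [K1] or
   [K2] is enlarged to the union. *)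
exists (K1 `|` K2, Num.min d1 d2 / 2)%R => /=.
  split; last by rewrite divr_gt0// lt_min d10.
  by move/fset0Pn: K10 => [k kK]; apply/fset0Pn; exists k; rewrite inE kK.
have aux (K : {fset G}) (d : R) F : K != fset0 -> K `<=` K1 `|` K2 ->
    (Num.min d1 d2 <= d)%R -> F != fset0 ->
    almost_invariant (K1 `|` K2) (Num.min d1 d2 / 2) F ->
    almost_invariant K d F.
  move=> K0 KK dd F0; rewrite /almost_invariant => h.
  have := card_symdiff_mulg_sub F K0 KK; rewrite -(ler_nat R) natrM => h2.
  apply: (le_lt_trans h2).
  have : (Num.min d1 d2 * #|` F|%:R <= d * #|` F|%:R)%R by exact: ler_wpM2r.
  by move: h; lra.
move=> F /= [F0 FK]; split; split => //; apply: aux FK => //.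
- exact: fsubsetUl.
- by rewrite ge_min lexx.
- exact: fsubsetUr.
- by rewrite ge_min lexx orbT.
Qed.

Lemma to_group_proper : amenable R G -> ProperFilter (to_group R G).
Proof.
move=> amG; apply: filter_from_proper; first exact: to_group_filter.
by move=> [K d] /= [K0 d0]; have [F F0 FK] := amG K d K0 d0; exists F.
Qed.

End Filter.

(** * Topology and measurability of cylinders and of the shift, and integration of functions of
    finitely many coordinates *)

Section Shift.
Variables (R : realType) (G : groupType).
Implicit Types (F : {fset G}) (nu : probability (borel_shift G) R).

Lemma restriction_eq F (x y : full_shift G) :
  restriction F x = restriction F y <-> forall g, g \in F -> x g = y g.
Proof.
split=> [/ffunP xy g gF|xy]; first by have := xy [` gF]; rewrite !ffunE.
by apply/ffunP => g; rewrite !ffunE; apply: xy; exact: valP.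
Qed.

(** Each coordinate is locally constant because [nat] is discrete, and [F] is finite, so
    [restriction F] is locally constant. This is why [Y] may be arbitrary. *)
Lemma open_restriction_preimage F (Y : set {ffun F -> nat}) :
  open (restriction F @^-1` Y).
Proof.
rewrite openE => x /= Yx; rewrite /interior.
have near_eq (g : F) : nbhs x [set y : full_shift G | y (val g) = x (val g)].
  have h : nbhs (x (val g)) [set x (val g)] by exact: (@discrete_set1 nat).
  exact: (@proj_continuous G (fun _ => nat) (val g) x _ h).
have nxE : nbhs x [set y : full_shift G | forall g : F, y (val g) = x (val g)].
  exact: (filter_forall _ near_eq).
apply: (filterS _ nxE) => y xy /=.
suff -> : restriction F y = restriction F x by [].
by apply/ffunP => g; rewrite !ffunE.
Qed.

Lemma measurable_restriction_preimage F (Y : set {ffun F -> nat}) :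
  measurable (restriction F @^-1` Y : set (borel_shift G)).
Proof. by apply: sub_sigma_algebra; exact: open_restriction_preimage. Qed.

Lemma measurable_cylinder F (w : {ffun F -> nat}) :
  measurable (cylinder w : set (borel_shift G)).
Proof. exact: (@measurable_restriction_preimage F [set w]). Qed.

Lemma continuous_shift_act (g : G) :
  continuous (shift_act g : full_shift G -> full_shift G).
Proof.
move=> x; apply/cvg_sup => h.
apply: (@continuous_comp_initial _ (full_shift G) nat
  (fun f : full_shift G => f h) (shift_act g)).
exact: (@proj_continuous G (fun _ => nat) (h * g)%g).
Qed.

Lemma measurable_shift_act (g : G) :
  measurable_fun [set: borel_shift G]
    (shift_act g : borel_shift G -> borel_shift G).
Proof.
apply: (@measurability _ _ (borel_shift G) (borel_shift G) setT _
  (@open (full_shift G))) => // _ [A oA <-].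
rewrite setTI; apply: sub_sigma_algebra; apply: open_comp => // x _.
exact: continuous_shift_act.
Qed.

Lemma measurable_comp_restriction F (f : {ffun F -> nat} -> \bar R) :
  measurable_fun [set: borel_shift G]
    (f \o restriction F : borel_shift G -> \bar R).
Proof.
move=> _ Y mY; rewrite setTI.
exact: (@measurable_restriction_preimage F (f @^-1` Y)).
Qed.

(** There are countably many words on [F], so the space splits into countably many measurable pieces
    on each of which the integrand is constant. *)
Lemma integral_comp_restriction nu F (f : {ffun F -> nat} -> \bar R) :
  (forall w, 0 <= f w) ->
  \int[nu]_x f (restriction F x) =
  \esum_(w in [set: {ffun F -> nat}]) (f w * nu (cylinder w)).
Proof.
move=> f0.
(* The pieces are indexed by the [pickle] code of the word, which makes them a sequence as countable
   additivity of the integral requires. A code that no word has gives an empty piece. *)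
pose A n : set (borel_shift G) := [set x | choice.pickle (restriction F x) = n].
have UA : \bigcup_n A n = setT.
  by apply/seteqP; split=> // x _; exists (choice.pickle (restriction F x)).
rewrite -UA ge0_integral_bigcup//; last 3 first.
- move=> n.
  exact: (@measurable_restriction_preimage F [set w | choice.pickle w = n]).
- by rewrite UA; exact: measurable_comp_restriction.
- by move=> i j _ _ [x [<- <-]].
have An (n : nat) : \int[nu]_(x in A n) f (restriction F x) =
    \esum_(w in [set w : {ffun F -> nat} | choice.pickle w = n])
      (f w * nu (cylinder w)).
  have [[w wn]|nw] := pselect (exists w : {ffun F -> nat}, choice.pickle w = n).
    have -> : [set w : {ffun F -> nat} | choice.pickle w = n] = [set w].
      apply/seteqP; split=> v /= ; last by move->.
      by rewrite -wn => /(pcan_inj choice.pickleK).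
    have AE : A n = cylinder w.
      by apply/seteqP; split=> v /= ; rewrite /A /cylinder/= -wn;
        [move=> /(pcan_inj choice.pickleK)|move->].
    rewrite esum_set1 ?mule_ge0// AE.
    rewrite -integral_cst; last exact: measurable_cylinder.
    by apply: eq_integral => x; rewrite inE /cylinder/= => ->.
  have -> : [set w : {ffun F -> nat} | choice.pickle w = n] = set0.
    by rewrite -subset0 => w wn; apply: nw; exists w.
  have -> : A n = set0.
    by rewrite -subset0 => w wn; apply: nw; eexists; exact: wn.
  by rewrite esum_set0 integral_set0.
rewrite (eq_eseriesr (fun n _ => An n)) nneseries_esumT//; last first.
  by move=> n; apply: esum_ge0 => w _; rewrite mule_ge0.
rewrite -(@esum_bigcupT R _ setT (fun n => [set w | choice.pickle w = n])
  (fun w : {ffun F -> nat} => f w * nu (cylinder w))).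
- by congr esum; apply/seteqP; split=> // w _; exists (choice.pickle w).
- by move=> i j _ _ [x [<- <-]].
- by move=> w; rewrite mule_ge0.
Qed.

End Shift.

(** * The Gibbs inequality and the bound of entropy by one-site entropy *)

Section Entropy.
Variables (R : realType) (G : groupType).
Implicit Types (F : {fset G}) (nu : probability (borel_shift G) R).

Lemma cylinder_fin_num nu F (w : {ffun F -> nat}) :
  nu (cylinder w) \is a fin_num.
Proof. by apply: fin_num_measure; exact: measurable_cylinder. Qed.

Lemma fine_cylinder_ge0 nu F (w : {ffun F -> nat}) :
  (0 <= fine (nu (cylinder w)))%R.
Proof. exact: fine_ge0. Qed.

Lemma fine_cylinder_le1 nu F (w : {ffun F -> nat}) :
  (fine (nu (cylinder w)) <= 1)%R.
Proof.
rewrite -lee_fin fineK ?cylinder_fin_num//; apply: probability_le1.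
exact: measurable_cylinder.
Qed.

Lemma neg_ln_ge0 (x : R) : (0 <= x <= 1)%R -> (0 <= - ln x)%R.
Proof. by move=> /andP[x0 x1]; rewrite oppr_ge0 ln_le0. Qed.

Lemma neg_ln_cylinder_ge0 nu F (w : {ffun F -> nat}) :
  (0 <= - ln (fine (nu (cylinder w))))%R.
Proof. by rewrite neg_ln_ge0// fine_cylinder_ge0 fine_cylinder_le1. Qed.

Lemma esum_cylinder nu F :
  \esum_(w in [set: {ffun F -> nat}]) nu (cylinder w) = 1.
Proof.
have := @integral_comp_restriction R G nu F (cst 1) (fun=> lee01).
rewrite [LHS]integral_cst// mul1e [LHS]probability_setT => ->.
by apply: eq_esum => w _; rewrite mul1e.
Qed.

(** Entropy becomes the mean of the information function, which can then be compared pointwise with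
    an ergodic sum. *)
Lemma shannon_entropyE nu F :
  shannon_entropy F nu =
  \int[nu]_x (- ln (fine (nu (cylinder (restriction F x)))))%:E.
Proof.
rewrite (@integral_comp_restriction R G nu F
  (fun w => (- ln (fine (nu (cylinder w))))%:E)); last first.
  by move=> w; rewrite lee_fin neg_ln_cylinder_ge0.
apply: eq_esum => w _.
by rewrite -[X in _ = _ * X]fineK ?cylinder_fin_num// -EFinM mulNr mulrC.
Qed.

(* Also valid for v = 0 because ln 0 = 0. *)
Lemma gibbs_pointwise (v c : R) : (0 <= v)%R -> (0 <= c)%R ->
  (c = 0 -> v = 0)%R -> (- (v * ln v) + v <= - ln c * v + c)%R.
Proof.
move=> v0 c0 cv; have [->|vN0] := eqVneq v 0%R.
  by rewrite mul0r oppr0 mulr0 !add0r.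
have cN0 : c != 0%R by apply: contra_neq vN0; exact: cv.
have vp : (0 < v)%R by rewrite lt_def vN0.
have cp : (0 < c)%R by rewrite lt_def cN0.
(* The estimate is [ln t <= t - 1] at [t = c / v], multiplied by [v]. *)
have : (-1 < c / v - 1)%R by have := divr_gt0 cp vp; lra.
move=> /le_ln1Dx; rewrite addrC subrK ln_div// => h.
have := ler_wpM2l v0 h; rewrite !mulrBr mulrCA divff// !mulr1; lra.
Qed.

(** This is nonnegativity of relative entropy, for weights [c] of total mass at most 1. The absolute
    continuity hypothesis matters because [ln 0 = 0]: a word of zero weight and positive mass would
    contribute 0 on the right instead of infinity. *)
Lemma gibbs_inequality nu F (c : {ffun F -> nat} -> R) :
  (forall w, 0 <= c w <= 1)%R -> (forall w, c w = 0%R -> nu (cylinder w) = 0) ->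
  \esum_(w in [set: {ffun F -> nat}]) (c w)%:E <= 1 ->
  shannon_entropy F nu <= \int[nu]_x (- ln (c (restriction F x)))%:E.
Proof.
move=> c01 cnu sumc.
have ln0 w : 0 <= (- ln (c w))%:E by rewrite lee_fin neg_ln_ge0.
rewrite (@integral_comp_restriction R G nu F (fun w => (- ln (c w))%:E))//.
(* Adding 1 to both sides, read as the total mass of [nu] on the left and bounded below by that of
   [c] on the right, leaves a termwise comparison in which no infinite quantities are subtracted. *)
rewrite -(@leeD2rE _ 1)//; apply: (le_trans _ (leeD2l _ sumc)).
rewrite -{1}(esum_cylinder nu F) /shannon_entropy -!esumD//; last first.
- move=> w _; rewrite lee_fin -mulrN mulr_ge0 ?fine_cylinder_ge0//.
  by rewrite neg_ln_cylinder_ge0.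
- by move=> w _; have /andP[] := c01 w; rewrite lee_fin.
- by move=> w _; rewrite mule_ge0.
apply: le_esum => w _.
rewrite -[X in _ + X <= _ * X + _]fineK ?cylinder_fin_num//.
rewrite -EFinM -!EFinD lee_fin.
apply: gibbs_pointwise; rewrite ?fine_cylinder_ge0//.
  by have /andP[] := c01 w.
by move=> /cnu ->.
Qed.

(** A finite set of words uses a bounded alphabet; the sum over all words in that alphabet factors
    into one partial sum of [a] per site, each at most 1. *)
Lemma esum_prod_le1 (I : finType) (a : nat -> R) :
  (forall n, 0 <= a n)%R -> \esum_(n in [set: nat]) (a n)%:E <= 1 ->
  \esum_(w in [set: {ffun I -> nat}]) (\prod_i a (w i))%:E <= 1.
Proof.
move=> a0 suma; apply: ub_ereal_sup => _ [X [finX _] <-].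
rewrite fsbig_finite//= sumEFin lee_fin.
set S := fset_set X.
pose N := (\max_(w <- S) \max_i w i)%N.
have wN w i : w \in S -> (w i < N.+1)%N.
  move=> wS; rewrite ltnS /N (big_rem w wS)/= leq_max.
  by rewrite (leq_bigmax (F := fun i => w i)).
(* Words with letters at most [N] are recoded over a finite type, where sums and products can be
   interchanged. *)
pose e (w : {ffun I -> nat}) : {ffun I -> 'I_N.+1} := [ffun i => inord (w i)].
have eS w : w \in S -> forall i, e w i = w i :> nat.
  by move=> wS i; rewrite ffunE inordK// wN.
have -> : (\sum_(w <- S) \prod_i a (w i) =
    \sum_(f <- [seq e w | w <- S]) \prod_i a (f i))%R.
  rewrite big_map big_seq [RHS]big_seq; apply: eq_bigr => w wS.
  by apply: eq_bigr => i _; rewrite eS.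
have uS : uniq [seq e w | w <- S].
  rewrite map_inj_in_uniq ?fset_uniq// => v w vS wS evw.
  by apply/ffunP => i; rewrite -eS// -[RHS]eS// evw.
rewrite big_uniq//=.
apply: (@le_trans _ _ (\sum_(f : {ffun I -> 'I_N.+1}) \prod_i a (f i))%R).
  rewrite big_mkcond/=; apply: ler_sum => f _; case: ifP => // _.
  exact: prodr_ge0.
rewrite -(bigA_distr_bigA (fun=> fun j : 'I_N.+1 => a j)).
apply: prodr_ile1 => i _; rewrite sumr_ge0//=.
rewrite -lee_fin -sumEFin; apply: le_trans suma; apply: esum_ge.
exists `I_N.+1; first by split.
by rewrite -fsbig_ord.
Qed.

Lemma ge0_integral_shift_act nu (f : borel_shift G -> \bar R) (g : G) :
  invariant_measure nu -> measurable_fun setT f -> (forall x, 0 <= f x) ->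
  \int[nu]_x f (shift_act g x) = \int[nu]_x f x.
Proof.
move=> invnu mf f0.
have mg := @measurable_shift_act G g.
have := @ge0_integral_pushforward _ _ _ _ R _ mg nu setT f measurableT mf.
rewrite preimage_setT /comp => <-//.
by apply: eq_measure_integral => A mA _; exact: invnu.
Qed.

Lemma integral_shift_act nu (f : borel_shift G -> \bar R) (g : G) :
  invariant_measure nu -> measurable_fun setT f ->
  \int[nu]_x f (shift_act g x) = \int[nu]_x f x.
Proof.
move=> invnu mf; rewrite integralE [RHS]integralE.
congr (_ - _).
- rewrite -(ge0_integral_shift_act g invnu (measurable_funepos mf))//.
  by apply: eq_integral => x _; rewrite !funeposE.
- rewrite -(ge0_integral_shift_act g invnu (measurable_funeneg mf))//.
  by apply: eq_integral => x _; rewrite !funenegE.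
Qed.

(** Only an inequality holds, because of [ln 0 = 0]: a vanishing factor makes the left side 0 while
    the other terms on the right stay nonnegative. Otherwise both sides agree. *)
Lemma ln_prod_le (I : finType) (a : I -> R) : (forall i, 0 <= a i <= 1)%R ->
  (- ln (\prod_i a i) <= \sum_i - ln (a i))%R.
Proof.
move=> a01.
have [[i ai0]|a0] := pselect (exists i, a i = 0%R).
  rewrite (bigD1 i)//= ai0 mul0r ln0// oppr0 sumr_ge0// => j _.
  exact: neg_ln_ge0.
rewrite sumrN lerN2.
suff [] : (0 < \prod_i a i)%R /\ (\sum_i ln (a i) = ln (\prod_i a i))%R.
  by move=> _ ->.
elim/big_ind2: _ => //.
- by rewrite ln1.
- move=> x1 x2 y1 y2 [x10 ->] [y10 ->]; rewrite mulr_gt0//; split => //.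
  by rewrite lnM// posrE.
- move=> i _; split => //; rewrite lt_def; have /andP[-> _] := a01 i.
  by rewrite andbT; apply/eqP => ai0; apply: a0; exists i.
Qed.

(* The reference weights are the product of the one-site marginals of nu. *)
Lemma shannon_entropy_le nu F : invariant_measure nu ->
  shannon_entropy F nu <= #|` F|%:R%:E * entropy1 nu.
Proof.
move=> invnu.
pose A (n : nat) : set (borel_shift G) := [set x : full_shift G | x 1%g = n].
pose a (n : nat) := fine (nu (A n)).
have cylA (x : full_shift G) : cylinder (restriction [fset 1%g] x) = A (x 1%g).
  apply/seteqP; split => y; rewrite /cylinder /A /=.
    by move/restriction_eq; apply; rewrite inE.
  by move=> y1; apply/restriction_eq => g; rewrite inE => /eqP ->.
have mA (n : nat) : measurable (A n).
  have := @measurable_cylinder G _ (restriction [fset 1%g] (fun=> n)).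
    by rewrite cylA.
have Afin (n : nat) : nu (A n) \is a fin_num by exact: fin_num_measure.
have a01 (n : nat) : (0 <= a n <= 1)%R.
  by rewrite fine_ge0//= -lee_fin fineK//; exact: probability_le1.
have suma : \esum_(n in [set: nat]) (a n)%:E <= 1.
  rewrite -nneseries_esumT; last first.
    by move=> n; rewrite lee_fin; have /andP[] := a01 n.
  rewrite (eq_eseriesr (fun n _ => fineK (Afin n))).
  have mU : measurable (\bigcup_n A n) by exact: bigcup_measurable.
  rewrite -measure_semi_bigcup//; first exact: probability_le1.
  by move=> i j _ _ [x [<- <-]].
have shiftA (g : G) (n : nat) : nu [set x : full_shift G | x g = n] = nu (A n).
  rewrite -(invnu g (A n))//; congr (nu _); apply/seteqP.
  by split => x; rewrite /A /shift_act /= mul1g.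
pose c (w : {ffun F -> nat}) := (\prod_g a (w g))%R.
have := @gibbs_inequality nu F c.
have c01 w : (0 <= c w <= 1)%R.
  rewrite prodr_ge0 /=; last by move=> g _; have /andP[] := a01 (w g).
  by rewrite prodr_ile1.
move=> /(_ c01) => {}/(_ _ _)/le_trans; apply; last 1 first.
- pose f (x : borel_shift G) : \bar R := (- ln (a ((x : full_shift G) 1%g)))%:E.
  have f0 x : 0 <= f x by rewrite lee_fin neg_ln_ge0.
  have mf : measurable_fun setT f.
    have -> : f = (fun w : {ffun [fset 1%g : G] -> nat} =>
        (- ln (fine (nu (cylinder w))))%:E) \o restriction [fset 1%g].
      by apply/funext => x /=; rewrite cylA.
    exact: measurable_comp_restriction.
  have -> : entropy1 nu = \int[nu]_x f x.
    rewrite /entropy1 shannon_entropyE.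
    by apply: eq_integral => x _; rewrite cylA.
  have mfs (g : G) :
      measurable_fun setT (f \o shift_act g : borel_shift G -> \bar R).
    by apply: (measurableT_comp mf); exact: measurable_shift_act.
  (* The information of the product weights is at most the sum over [F] of translates of the
     one-site information [f], and by invariance all these translates have the same integral. *)
  apply: (@le_trans _ _ (\int[nu]_x \sum_(g : F) f (shift_act (val g) x))).
    apply: ge0_le_integral => //.
    + by move=> x _; rewrite lee_fin neg_ln_ge0.
    + exact: (@measurable_comp_restriction R G F (fun w => (- ln (c w))%:E)).
    + by apply: emeasurable_sum => g; exact: mfs.
    + move=> x _; rewrite sumEFin lee_fin.
      apply: (le_trans (ln_prod_le _)) => //.
      by apply: ler_sum => g _; rewrite /shift_act mul1g ffunE.
  rewrite ge0_integral_sum//; last by move=> g; exact: mfs.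
  rewrite (eq_bigr (fun=> \int[nu]_x f x)) => [|g _]; last first.
    exact: integral_shift_act.
  by rewrite cardfE mule_natl sumr_const.
(* Absolute continuity: a zero product has a zero marginal at some site [g], and the cylinder of [w]
   lies in the corresponding null one-site event [B]. *)
- move=> w cw0; have /prodf_eq0[g _ /eqP ag0] : c w == 0%R by rewrite cw0.
  pose B := restriction F @^-1` [set v | v g = w g] : set (borel_shift G).
  have nuB : nu B = 0.
    have -> : B = [set x : full_shift G | x (val g) = w g].
      by apply/seteqP; split=> x; rewrite /B /= ffunE.
    by rewrite shiftA -[LHS]fineK// -/(a (w g)) ag0.
  apply/eqP; rewrite eq_le measure_ge0 andbT -nuB le_measure ?inE//.
  + exact: measurable_cylinder.
  + exact: measurable_restriction_preimage.
  + by move=> x; rewrite /B /cylinder /= => ->.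
- by apply: esum_prod_le1 => // n; have /andP[] := a01 n.
Qed.

End Entropy.

(** * Boundedness, measurability and integrability of the potential *)

Section Potential.
Variables (R : realType) (G : groupType).
Implicit Types (F : {fset G}) (nu : probability (borel_shift G) R).
Implicit Types phi : full_shift G -> R.

Lemma exp_summable_bounded phi :
  exp_summable phi -> exists M : R, forall x, (phi x <= M)%R.
Proof.
pose u a := expeR (ereal_sup
  [set (phi x)%:E | x in [set x : full_shift G | x 1%g = a]]).
have u0 a : 0 <= u a by exact: expeR_ge0.
rewrite /exp_summable nneseries_esumT// => S_fin.
set S := \esum_(_ in _) _ in S_fin.
have S0 : 0 <= S by apply: esum_ge0 => a _; exact: u0.
(* The sum bounds each [exp (phi x)], and [phi x <= exp (phi x) - 1], so the sum itself serves as
   the bound. *)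
exists (fine S) => x.
have : (expR (phi x))%:E <= S.
  apply: (@le_trans _ _ (u (x 1%g))).
    rewrite -[(expR _)%:E]/(expeR (phi x)%:E) lee_expeR.
    by apply: ereal_sup_ubound; exists x.
  apply: esum_ge; exists [set x 1%g]; first by split; [exact: finite_set1|].
  by rewrite fsbig_set1.
rewrite -{1}(@fineK _ S) ?ge0_fin_numE// lee_fin; apply: le_trans.
by have := expR_ge1Dx (phi x); lra.
Qed.

Lemma local_variation_ge0 phi E : 0 <= local_variation phi E.
Proof.
apply: ereal_sup_ubound; exists point, point; split => //.
by rewrite subrr normr0.
Qed.

(** Strict growth of [E] makes every weight of the series at least 1, so variations all bounded
    below by [e] would force divergence. *)
Lemma summable_variation_small phi (E : nat -> {fset G}) :
  exhausting_sequence E -> summable_variation E phi ->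
  forall e : R, (0 < e)%R -> exists m, local_variation phi (E m) < e%:E.
Proof.
move=> [_ _ E_incr _] + e e0; apply: contraPP => /forallNP noE.
have eE m : e%:E <= local_variation phi (E m) by rewrite leNgt; apply/negP.
pose u m := #|` fset_invg (E m.+1) `\` fset_invg (E m)|%:R%:E *
  local_variation phi (E m).
rewrite /summable_variation -[X in X < _]/(\sum_(1 <= m <oo) u m) => u_lty.
have ue m : e%:E <= u m.
  have := E_incr m; rewrite fproperE => /andP[_].
  rewrite -fsetD_eq0 => /fset0Pn[g]; rewrite inE => /andP[gNE gE].
  apply: (le_trans (eE m)); rewrite /u lee_pemull ?local_variation_ge0//.
  rewrite lee_fin (ler_nat R 1) cardfs_gt0; apply/fset0Pn.
  exists g^-1%g; rewrite inE; apply/andP; split.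
    by apply: contra gNE => /imfsetP[h /= hE /invg_inj ->].
  by apply/imfsetP; exists g.
have u0 m : 0 <= u m by apply: le_trans (ue m); rewrite lee_fin ltW.
set S := \sum_(1 <= m <oo) _ in u_lty.
have S0 : 0 <= S by apply: nneseries_ge0 => m _ _; exact: u0.
have Sfin : S \is a fin_num by rewrite ge0_fin_numE.
have leS n : (n%:R * e <= fine S)%R.
  rewrite -lee_fin fineK// /S.
  (* The series starts at index 1, so the partial sum stopped before [n.+1] has exactly [n]
     terms. *)
  apply: (le_trans _ (@nneseries_lim_ge _ u xpredT 1 n.+1 _)) => //.
  rewrite big_add1/= big_mkord.
  apply: (@le_trans _ _ (\sum_(i < n) e%:E)); last by apply: lee_sum.
  by rewrite sumEFin sumr_const card_ord mulr_natl.
have := leS (Num.bound (fine S / e)).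
rewrite -ler_pdivlMr// leNgt => /negP; apply.
by apply: archi_boundP; rewrite divr_ge0 ?fine_ge0// ltW.
Qed.

(** The sets where [phi] exceeds [a] are open: around such an [x], a cylinder on which [phi] varies
    by less than [phi x - a] stays above [a]. *)
Lemma summable_variation_measurable phi (E : nat -> {fset G}) :
  exhausting_sequence E -> summable_variation E phi ->
  measurable_fun setT (EFin \o phi : borel_shift G -> \bar R).
Proof.
move=> exE sumE.
apply: (measurability _ (ErealGenOInfty.measurableE R)).
move=> _ [_ [a ->] <-]; rewrite setTI; apply: sub_sigma_algebra.
rewrite openE => x; rewrite /= in_itv/= andbT lte_fin => ax.
have e0 : (0 < phi x - a)%R by rewrite subr_gt0.
have [m mE] := summable_variation_small exE sumE e0.
have := @open_restriction_preimage G (E m) [set restriction (E m) x].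
rewrite openE => /(_ x erefl); apply: filterS => y /= yx.
rewrite in_itv/= andbT lte_fin.
have : `|phi x - phi y|%:E < (phi x - a)%:E.
  apply: le_lt_trans mE; apply: ereal_sup_ubound; exists x, y.
  by split => //; rewrite yx.
rewrite lte_fin; have := ler_norm (phi x - phi y); lra.
Qed.

(** The upper bound makes the positive part integrable, and an infinite negative part would make the
    integral [-oo]. *)
Lemma phi_integral_integrable nu phi (M : R) :
  measurable_fun setT (EFin \o phi : borel_shift G -> \bar R) ->
  (forall x, phi x <= M)%R ->
  -oo < phi_integral phi nu -> nu.-integrable setT (EFin \o phi).
Proof.
move=> mphi phiM phi_gt; apply/integrableP; split => //.
have pos_lty : \int[nu]_x (EFin \o phi)^\+ x < +oo.
  apply: (@le_lt_trans _ _ (\int[nu]_x (Num.max M 0)%:E)).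
    apply: ge0_le_integral => //.
    - exact: measurable_funepos.
    - move=> x _; rewrite funeposE -EFin_max lee_fin ge_max !le_max.
      by rewrite phiM lexx orbT.
  by rewrite integral_cst//= probability_setT mule1 ltry.
have neg_lty : \int[nu]_x (EFin \o phi)^\- x < +oo.
  rewrite ltey; apply/eqP => neg_y; move: phi_gt.
  rewrite /phi_integral integralE neg_y /=.
  by rewrite addeNy ltxx.
rewrite (_ : (fun x => `|(EFin \o phi) x|) = (abse \o (EFin \o phi)))//.
rewrite fune_abse.
rewrite ge0_integralD//; first exact: lte_add_pinfty.
- exact: measurable_funepos.
- exact: measurable_funeneg.
Qed.

Section Invariant.
Variables (nu : probability (borel_shift G) R) (phi : full_shift G -> R).
Hypothesis invnu : invariant_measure nu.
Hypothesis iphi : nu.-integrable setT (EFin \o phi).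

Let mphi : measurable_fun setT (EFin \o phi : borel_shift G -> \bar R).
Proof. exact: measurable_int iphi. Qed.

Lemma integrable_shift_act (g : G) :
  nu.-integrable setT (EFin \o (phi \o shift_act g)).
Proof.
apply/integrableP; split.
  by apply: (measurableT_comp mphi); exact: measurable_shift_act.
have /integrableP[_] := iphi; apply: le_lt_trans.
rewrite (@integral_shift_act _ _ nu (abse \o (EFin \o phi)) g)//.
exact: measurableT_comp.
Qed.

Lemma integrable_ergodic_sum F :
  nu.-integrable setT (EFin \o ergodic_sum phi F).
Proof.
have -> : EFin \o ergodic_sum phi F =
    (fun x => \sum_(g <- F) (EFin \o (phi \o shift_act g)) x).
  by apply/funext => x /=; rewrite sumEFin.
by apply: integrable_sum => // g _; exact: integrable_shift_act.
Qed.

Lemma integral_ergodic_sum F :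
  \int[nu]_x (ergodic_sum phi F x)%:E = #|` F|%:R%:E * phi_integral phi nu.
Proof.
under eq_integral do rewrite /ergodic_sum -sumEFin.
rewrite (@integral_sum _ _ _ nu setT _ _
  (fun g : G => EFin \o (phi \o shift_act g)))//; last first.
  by move=> g; exact: integrable_shift_act.
under eq_bigr do rewrite /= (@integral_shift_act _ _ nu (EFin \o phi))//.
rewrite -/(phi_integral phi nu) -(@fineK _ (phi_integral phi nu)); last first.
  exact: integrable_fin_num iphi.
by rewrite sumEFin big_const_seq count_predT iter_addr_0 -EFinM mulr_natl.
Qed.

End Invariant.
End Potential.

(** * Entropy estimates from the Bowen-Gibbs bounds *)

Section Gibbs.
Variables (R : realType) (G : groupType).
Implicit Types (F : {fset G}) (mu nu : probability (borel_shift G) R).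
Implicit Types phi : full_shift G -> R.

(** Positivity of [m] is extracted from the lower bound first, so that the default value [ln 0 = 0]
    cannot interfere with taking logarithms. *)
Lemma ln_gibbs_bounds (m s e : R) :
  (expR (- e) <= m / expR s <= expR e)%R ->
  (0 < m)%R /\ (s - e <= ln m <= s + e)%R.
Proof.
move=> /andP[lo hi].
have m0 : (0 < m)%R.
  have : (0 < m / expR s)%R by apply: lt_le_trans lo; exact: expR_gt0.
  by rewrite pmulr_lgt0// invr_gt0 expR_gt0.
split=> //.
have q0 : (0 < m / expR s)%R by rewrite divr_gt0 ?expR_gt0.
have : (ln (expR (- e)) <= ln (m / expR s))%R.
  by rewrite ler_ln ?posrE ?expR_gt0.
have : (ln (m / expR s) <= ln (expR e))%R.
  by rewrite ler_ln ?posrE ?expR_gt0.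
rewrite ln_div ?posrE ?expR_gt0// !expRK; lra.
Qed.

Lemma bowen_gibbs_near phi mu : bowen_gibbs phi mu ->
  exists p : R, forall eps : R, (0 < eps)%R ->
  \forall F \near to_group R G, F != fset0 /\ forall x,
    (0 < fine (mu (cylinder (restriction F x))))%R /\
    (ergodic_sum phi F x - (p + eps) * #|` F|%:R
       <= ln (fine (mu (cylinder (restriction F x))))
       <= ergodic_sum phi F x - (p - eps) * #|` F|%:R)%R.
Proof.
move=> [p gibbs]; exists p => eps eps0.
have [K [d [K0 d0 KdP]]] := gibbs eps eps0.
exists (K, d) => //= F [F0 FK]; split => // x.
have := KdP F F0 FK x; rewrite mulNr => /ln_gibbs_bounds[m0 /andP[lo hi]].
by split => //; apply/andP; split; lra.
Qed.

Lemma integral_cst_probability nu (b : R) :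
  \int[nu]_x (EFin \o cst b) x = b%:E.
Proof.
have := @integral_cst _ _ _ nu setT measurableT b%:E.
by rewrite [X in _ = _ * X]probability_setT mule1.
Qed.

(** The masses under [mu] are the weights in the Gibbs inequality; the pointwise lower bound on
    their logarithm is then integrated against [nu], where invariance evaluates the ergodic sum. *)
Lemma shannon_entropy_le_gibbs phi mu nu F (b : R) :
  invariant_measure nu -> nu.-integrable setT (EFin \o phi) ->
  (forall x, 0 < fine (mu (cylinder (restriction F x))))%R ->
  (forall x, ergodic_sum phi F x - b
     <= ln (fine (mu (cylinder (restriction F x)))))%R ->
  shannon_entropy F nu <= b%:E - #|` F|%:R%:E * phi_integral phi nu.
Proof.
move=> invnu iphi mu0 lnmu.
apply: (le_trans (@gibbs_inequality R G nu F
  (fun w => fine (mu (cylinder w))) _ _ _)).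
- by move=> w; rewrite fine_cylinder_ge0 fine_cylinder_le1.
(* Positivity is assumed for words read off a point; a word read off no point has an empty
   cylinder. *)
- move=> w muw0; have [[x xw]|nw] := pselect (exists x, restriction F x = w).
    by have := mu0 x; rewrite xw muw0 ltxx.
  rewrite (_ : cylinder w = set0) ?measure0// -subset0 => x xw.
  by apply: nw; exists x.
- rewrite -(esum_cylinder mu F) le_eqVlt; apply/orP; left; apply/eqP.
  by apply: eq_esum => w _; rewrite fineK// cylinder_fin_num.
have isum := integrable_ergodic_sum invnu iphi F.
have ib : nu.-integrable setT (EFin \o (cst b : borel_shift G -> R)).
  exact: finite_measure_integrable_cst.
rewrite -(integral_ergodic_sum invnu iphi F).
rewrite -[b%:E](integral_cst_probability nu) -integralB//.
apply: ge0_le_integral => //.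
- by move=> x _; rewrite lee_fin neg_ln_cylinder_ge0.
- exact: (@measurable_comp_restriction R G F
    (fun w => (- ln (fine (mu (cylinder w))))%:E)).
- by apply: (measurable_int nu); exact: integrableB.
- by move=> x _; rewrite /= -EFinB lee_fin; have := lnmu x; lra.
Qed.

(** With [nu = mu] the entropy is exactly the integral of the information function, so the opposite
    pointwise bound integrates to a lower estimate. *)
Lemma shannon_entropy_ge_gibbs phi mu F (b : R) :
  invariant_measure mu -> mu.-integrable setT (EFin \o phi) ->
  (forall x, ln (fine (mu (cylinder (restriction F x))))
     <= ergodic_sum phi F x - b)%R ->
  b%:E - #|` F|%:R%:E * phi_integral phi mu <= shannon_entropy F mu.
Proof.
move=> invmu iphi lnmu; rewrite shannon_entropyE.
have isum := integrable_ergodic_sum invmu iphi F.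
have ib : mu.-integrable setT (EFin \o (cst b : borel_shift G -> R)).
  exact: finite_measure_integrable_cst.
rewrite -(integral_ergodic_sum invmu iphi F).
rewrite -[b%:E](integral_cst_probability mu) -integralB//.
pose f (w : {ffun F -> nat}) := (- ln (fine (mu (cylinder w))))%:E.
have f0 w : 0 <= f w.
  by rewrite lee_fin neg_ln_cylinder_ge0.
have mf := @measurable_comp_restriction R G F f.
rewrite -[leRHS]/(\int[mu]_x (f \o restriction F) x).
(* [le_integral] compares integrable functions, so infinite entropy is set apart. *)
have [->|f_lty] := eqVneq (\int[mu]_x (f \o restriction F) x) +oo.
  exact: leey.
apply: le_integral => //.
- exact: integrableB.
- apply/integrableP; split => //.
  rewrite (eq_integral (f \o restriction F : borel_shift G -> \bar R)) ?ltey//.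
  by move=> x _; exact: gee0_abs (f0 _).
- by move=> x _; rewrite /= -EFinB lee_fin; have := lnmu x; lra.
Qed.

(** One set [F] with error 1 suffices. For [g] in [F], the nonnegative [psi] at the translate by [g]
    is at most its sum over [F], which the Gibbs bound dominates by a constant plus the information
    on [F]. *)
Lemma bowen_gibbs_integrable phi mu (M : R) :
  amenable R G -> invariant_measure mu -> entropy1 mu < +oo ->
  measurable_fun setT (EFin \o phi : borel_shift G -> \bar R) ->
  (forall x, phi x <= M)%R -> bowen_gibbs phi mu ->
  mu.-integrable setT (EFin \o phi).
Proof.
move=> amG invmu Hmu mphi phiM gibbs.
have FP := to_group_proper amG.
have [p near_gibbs] := bowen_gibbs_near gibbs.
have [F [F0 FP1]] := filter_ex (near_gibbs 1%R ltr01).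
have [g gF] := fset0Pn _ F0.
have HF : shannon_entropy F mu < +oo.
  apply: (le_lt_trans (shannon_entropy_le F invmu)).
  by rewrite lte_mul_pinfty// lee_fin.
pose b := ((p - 1) * #|` F|%:R)%R.
pose psi x := (M - phi x)%R.
have psi0 x : (0 <= psi x)%R by rewrite subr_ge0.
have mpsi : measurable_fun setT (EFin \o psi : borel_shift G -> \bar R).
  apply/measurable_EFinP; apply: measurable_funB; first exact: measurable_cst.
  exact/measurable_EFinP.
have psi_lty : \int[mu]_x (EFin \o psi) x < +oo.
  rewrite -(integral_shift_act g invmu mpsi).
  (* The absolute value makes the constant nonnegative, so that additivity of the integral of
     nonnegative functions applies. *)
  pose C := `|M * #|` F|%:R - b|%R.
  apply: (@le_lt_trans _ _ (C%:E + shannon_entropy F mu)); last first.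
    by rewrite lte_add_pinfty// ltry.
  rewrite shannon_entropyE -[C%:E](integral_cst_probability mu).
  pose f (w : {ffun F -> nat}) := (- ln (fine (mu (cylinder w))))%:E.
  have f0 w : 0 <= f w.
    by rewrite lee_fin neg_ln_cylinder_ge0.
  have mf := @measurable_comp_restriction R G F f.
  rewrite -[X in _ <= _ + X]/(\int[mu]_x (f \o restriction F) x).
  have C0 : (0 <= C)%R by exact: normr_ge0.
  have mC : measurable_fun setT (EFin \o cst C : borel_shift G -> \bar R).
    exact: (measurable_cst C%:E).
  rewrite -(@ge0_integralD _ (borel_shift G) R mu setT measurableT
    (EFin \o cst C) (f \o restriction F))//; last first.
    by move=> x _; exact: f0.
  apply: ge0_le_integral => //.
  - by move=> x _; rewrite lee_fin.
  - exact: (measurableT_comp mpsi (@measurable_shift_act G g)).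
  - exact: emeasurable_funD.
  - move=> x _; rewrite /= -EFinD lee_fin.
    have [_ /andP[_ hi]] := FP1 x.
    have : (psi (shift_act g x) <= \sum_(h <- F) psi (shift_act h x))%R.
      rewrite (big_rem g)//= lerDl; exact: sumr_ge0.
    rewrite /psi big_split /= sumrN big_const_seq count_predT iter_addr_0.
    rewrite -mulr_natr -/(ergodic_sum phi F x).
    have := ler_norm (M * #|` F|%:R - b)%R; rewrite -/C /b; move: hi.
    by rewrite (_ : #|` F| = size F)//; lra.
have ipsi : mu.-integrable setT (EFin \o psi : borel_shift G -> \bar R).
  apply/integrableP; split => //; apply: le_lt_trans psi_lty.
  rewrite (eq_integral (EFin \o psi : borel_shift G -> \bar R))// => x _.
  by rewrite gee0_abs// lee_fin.
have iM : mu.-integrable setT (EFin \o cst M : borel_shift G -> \bar R).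
  exact: finite_measure_integrable_cst.
have := integrableB measurableT iM ipsi; congr (mu.-integrable _ _).
by apply/funext => x; rewrite /= /psi -EFinB; congr EFin; lra.
Qed.

(** Eventual upper bounds are assumed rather than convergence, so that the result covers every
    competitor [nu]. *)
Lemma ks_entropy_le nu (c : R) : amenable R G ->
  (forall eps : R, (0 < eps)%R -> \forall F \near to_group R G,
     (#|` F|%:R^-1)%:E * shannon_entropy F nu <= (c + eps)%:E) ->
  ks_entropy nu <= c%:E.
Proof.
move=> amG ub; have FP := to_group_proper amG.
apply/lee_addgt0Pr => e e0; rewrite -EFinD.
have [cv|ncv] := pselect (cvg ((fun F : {fset G} =>
  (#|` F|%:R^-1)%:E * shannon_entropy F nu) @ to_group R G)).
  exact: lime_le (ub e e0).
(* If the limit does not exist, [lim] is the default point 0 of \bar R. *)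
rewrite /ks_entropy dvgP//.
(* By amenability some [F] satisfies the bound; entropy is nonnegative, hence so is [c + e]. *)
have [F] := filter_ex (ub e e0); apply: le_trans.
rewrite mule_ge0 ?lee_fin ?invr_ge0// shannon_entropyE.
apply: integral_ge0 => x _.
by rewrite lee_fin neg_ln_cylinder_ge0.
Qed.

End Gibbs.

(** * The constant [p] as the common value of the supremum and of [mu] *)

Theorem theorem5p13 (R : realType) (G : groupType)
    (G_countable : countable [set: G]%classic)
    (G_amenable : amenable R G)
    (E : nat -> {fset G}) (E_exhausting : exhausting_sequence E)
    (phi : full_shift G -> R)
    (phi_exp_summable : exp_summable phi)
    (phi_summable_variation : summable_variation E phi)
    (mu : probability (borel_shift G) R)
    (mu_invariant : invariant_measure mu)
    (mu_bowen_gibbs : bowen_gibbs phi mu)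
    (mu_entropy : (entropy1 mu < +oo)%E) :
  equilibrium_measure phi mu.
Proof.
have FP := to_group_proper G_amenable.
have [M phiM] := exp_summable_bounded phi_exp_summable.
have mphi := summable_variation_measurable E_exhausting phi_summable_variation.
have imu := bowen_gibbs_integrable G_amenable mu_invariant mu_entropy mphi phiM
  mu_bowen_gibbs.
have [p gibbs] := bowen_gibbs_near mu_bowen_gibbs.
have ub (nu : probability (borel_shift G) R) (I : R) : invariant_measure nu ->
    nu.-integrable setT (EFin \o phi) -> phi_integral phi nu = I%:E ->
    forall eps : R, (0 < eps)%R -> \forall F \near to_group R G,
     (#|` F|%:R^-1)%:E * shannon_entropy F nu <= (p - I + eps)%:E.
  move=> invnu inu IE eps eps0; apply: filterS (gibbs eps eps0) => F [F0 FP1].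
  have cF : (0 < #|` F|%:R :> R)%R by rewrite ltr0n cardfs_gt0.
  rewrite lee_pdivrMl//.
  apply: (le_trans (shannon_entropy_le_gibbs invnu inu (fun x => (FP1 x).1)
    (fun x => proj1 (andP (FP1 x).2)))).
  by rewrite IE -!EFinM -EFinB lee_fin; lra.
have ints (nu : probability (borel_shift G) R) :
    nu.-integrable setT (EFin \o phi) ->
    phi_integral phi nu = (fine (phi_integral phi nu))%:E.
  by move=> inu; rewrite fineK//; exact: integrable_fin_num inu.
have ksmu : ks_entropy mu = (p - fine (phi_integral phi mu))%:E.
  set I := fine _; have IE : phi_integral phi mu = I%:E by exact: ints.
  apply: cvg_lim => //.
  (* The two Gibbs estimates squeeze the normalised entropy of [mu] to [p - I], which also proves
     that the limit exists. *)
  have both (eps : R) : (0 < eps)%R -> \forall F \near to_group R G,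
      (p - I - eps)%:E <= (#|` F|%:R^-1)%:E * shannon_entropy F mu
        <= (p - I + eps)%:E.
    move=> eps0; have ubF := ub mu I mu_invariant imu IE eps eps0.
    apply: filterS2 (gibbs eps eps0) ubF => F [F0 FP1] ->; rewrite andbT.
    have cF : (0 < #|` F|%:R :> R)%R by rewrite ltr0n cardfs_gt0.
    rewrite lee_pdivlMl//.
    apply: (le_trans _ (shannon_entropy_ge_gibbs mu_invariant imu
      (fun x => proj2 (andP (FP1 x).2)))).
    by rewrite IE -!EFinM -EFinB lee_fin; lra.
  (* Convergence in the extended reals splits into eventual finiteness, obtained from error 1, and
     convergence of the real values. *)
  apply/fine_cvgP; split.
    apply: filterS (both 1%R ltr01) => F /andP[lo hi].
    by rewrite fin_numElt (lt_le_trans _ lo) ?ltNyr// (le_lt_trans hi) ?ltry.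
  apply/cvgrPdist_le => eps eps0; apply: filterS (both eps eps0) => F /=.
  case: (_ * shannon_entropy F mu) => [r| |]//=; last by rewrite leye_eq andbF.
  by rewrite !lee_fin ler_norml; lra.
have key (nu : probability (borel_shift G) R) :
    invariant_measure nu -> nu.-integrable setT (EFin \o phi) ->
    ks_entropy nu + phi_integral phi nu <= p%:E.
  move=> invnu inu; have IE := ints nu inu.
  rewrite IE -leeBrDr// -EFinB; apply: ks_entropy_le => //.
  exact: ub.
have mu_gt : -oo < phi_integral phi mu by rewrite ints// ltNyr.
have mu_p : ks_entropy mu + phi_integral phi mu = p%:E.
  by rewrite ksmu [X in _ + X]ints// -EFinD subrK.
split => //; apply/eqP; rewrite eq_le; apply/andP; split.
  by apply: ereal_sup_ubound; exists mu.
(* A competitor is only known to have integral above [-oo]; the bound [M] upgrades this to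
   integrability, as [key] requires. *)
rewrite mu_p; apply: ub_ereal_sup => _ [nu [invnu nu_gt] <-].
by apply: key => //; exact: phi_integral_integrable mphi phiM nu_gt.
Qed.
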